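(* Let $\alpha,\beta,\gamma$ be real parameters and let $\epsilon$ be an arbitrary parameter. The Chihara polynomials $C_n(x)=C_n(x;\alpha,\beta,\gamma)$ satisfy the one-parameter family of eigenvalue equations $$\mathcal{D}^{(\epsilon)}C_n(x;\alpha,\beta,\gamma)=\lambda_n^{(\epsilon)}C_n(x;\alpha,\beta,\gamma),$$ where the eigenvalues are, for $n=0,1,2,\ldots$, $$\lambda_{2n}^{(\epsilon)}=n(n+\alpha+\beta+1),\qquad \lambda_{2n+1}^{(\epsilon)}=n(n+\alpha+\beta+2)+\epsilon,$$ and where $\mathcal{D}^{(\epsilon)}$ is the second-order differential Dunkl operator $$\mathcal{D}^{(\epsilon)}=S_x\partial_x^2+T_x\partial_xR+U_x\partial_x+V_x(\mathbb{I}-R)$$ with coefficients $$S_x=\frac{(x^2-\gamma^2)(x^2-\gamma^2-1)}{4x^2},\qquad T_x=\frac{\gamma(x-\gamma)(x^2-\gamma^2-1)}{4x^3},$$ $$U_x=\frac{\gamma(x^2-\gamma^2-1)(2\gamma-x)}{4x^3}+\frac{(x^2-\gamma^2)(\alpha+\beta+3/2)}{2x}-\frac{\alpha+1/2}{2x},$$ $$V_x=\frac{\gamma(x^2-\gamma^2-1)(x-3\gamma/2)}{4x^4}-\frac{(x^2-\gamma^2)(\alpha+\beta+3/2)}{4x^2}+\frac{\alpha+1/2}{4x^2}+\epsilon\,\frac{x-\gamma}{2x}.$$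
   Context: $R$ is the reflection operator $Rf(x)=f(-x)$, $\mathbb{I}$ is the identity, and $\partial_xR$ means first apply $R$ and then differentiate, i.e. $(\partial_xRf)(x)=-f'(-x)$. $(a)_n=a(a+1)\cdots(a+n-1)$, $(a)_0=1$, is the Pochhammer symbol and ${}_2F_1$ is the Gauss hypergeometric series (terminating here). The Chihara polynomials $C_n(x;\alpha,\beta,\gamma)$ are the monic polynomials of degree $n$ in $x$ defined by $$C_{2n}(x)=(-1)^n\frac{(\alpha+1)_n}{(n+\alpha+\beta+1)_n}\,{}_2F_1\!\left[{-n,\;n+\alpha+\beta+1\atop \alpha+1};x^2-\gamma^2\right],$$ $$C_{2n+1}(x)=(-1)^n\frac{(\alpha+2)_n}{(n+\alpha+\beta+2)_n}\,(x-\gamma)\,{}_2F_1\!\left[{-n,\;n+\alpha+\beta+2\atop \alpha+2};x^2-\gamma^2\right].$$ The parameters are assumed to be such that these expressions are defined: $\alpha+\beta\notin\{-2,-3,\ldots\}$, with the products $(\alpha+1)_n\,{}_2F_1$ and $(\alpha+2)_n\,{}_2F_1$ understood as polynomials in $x$ and $\alpha$ (expanded termwise). *)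

(* Defs.v *)
From HB Require Import structures.
From mathcomp Require Import all_boot all_order all_algebra.
From mathcomp Require Import ring.
From mathcomp Require Import all_classical reals topology normedtype derive.

Set Implicit Arguments.
Unset Strict Implicit.
Unset Printing Implicit Defensive.

Import Order.TTheory GRing.Theory Num.Theory.
Import numFieldNormedType.Exports.

Local Open Scope ring_scope.

(* K is the field of real numbers, or the complex numbers if the free parameter
   eps of the operator is to be complex. *)
Section Chihara.
Variable K : numFieldType.

Definition pochhammer (a : K) (n : nat) : K := \prod_(i < n) (a + i%:R).

(* The polynomial (c)_n 2F1(-n, b; c; z), expanded termwise through
   (c)_n / (c)_k = (c + k)_(n - k), so that no value of c is excluded. *)
Definition poch_hyp2F1 (n : nat) (b c : K) (z : {poly K}) : {poly K} :=
  \sum_(k < n.+1)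
    (pochhammer (- n%:R) k * pochhammer b k * pochhammer (c + k%:R) (n - k)
       / k`!%:R) *: z ^+ k.

Lemma pochhammerD (a : K) (m n : nat) :
  pochhammer a (m + n) = pochhammer a m * pochhammer (a + m%:R) n.
Proof.
rewrite /pochhammer big_split_ord /=; congr (_ * _).
by apply: eq_bigr => i _; rewrite natrD addrA.
Qed.

Lemma poch_hyp2F1E (n : nat) (b c : K) (z : {poly K}) :
  pochhammer c n != 0 ->
  poch_hyp2F1 n b c z =
  pochhammer c n *:
    \sum_(k < n.+1)
      (pochhammer (- n%:R) k * pochhammer b k / (pochhammer c k * k`!%:R))
        *: z ^+ k.
Proof.
move=> cn0; rewrite scaler_sumr; apply: eq_bigr => -[k /= kn] _.
rewrite scalerA; congr (_ *: _).
have cnE := pochhammerD c k (n - k); rewrite subnKC // in cnE.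
have ck0 : pochhammer c k != 0.
  by apply: contra_neq cn0 => ck0; rewrite cnE ck0 mul0r.
have kf0 : k`!%:R != 0 :> K by rewrite pnatr_eq0 -lt0n fact_gt0.
by rewrite cnE; field; rewrite kf0 ck0.
Qed.

(* The polynomials C_(2m) and C_(2m+1). *)
Definition chihara_even (alpha beta gamma : K) (m : nat) : {poly K} :=
  ((-1) ^+ m / pochhammer (m%:R + alpha + beta + 1) m) *:
    poch_hyp2F1 m (m%:R + alpha + beta + 1) (alpha + 1) ('X^2 - (gamma ^+ 2)%:P).

Definition chihara_odd (alpha beta gamma : K) (m : nat) : {poly K} :=
  ((-1) ^+ m / pochhammer (m%:R + alpha + beta + 2) m) *:
    (('X - gamma%:P) *
     poch_hyp2F1 m (m%:R + alpha + beta + 2) (alpha + 2)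
       ('X^2 - (gamma ^+ 2)%:P)).

Definition chihara (alpha beta gamma : K) (n : nat) : {poly K} :=
  if odd n then chihara_odd alpha beta gamma n./2
  else chihara_even alpha beta gamma n./2.

Definition chihara_eigenvalue (alpha beta eps : K) (n : nat) : K :=
  let m : K := n./2%:R in
  if odd n then m * (m + alpha + beta + 2) + eps
  else m * (m + alpha + beta + 1).

Definition reflection (f : K -> K) : K -> K := fun x => f (- x).

Definition dunkl_S (gamma x : K) : K :=
  (x ^+ 2 - gamma ^+ 2) * (x ^+ 2 - gamma ^+ 2 - 1) / (4 * x ^+ 2).

Definition dunkl_T (gamma x : K) : K :=
  gamma * (x - gamma) * (x ^+ 2 - gamma ^+ 2 - 1) / (4 * x ^+ 3).

Definition dunkl_U (alpha beta gamma x : K) : K :=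
  gamma * (x ^+ 2 - gamma ^+ 2 - 1) * (2 * gamma - x) / (4 * x ^+ 3)
  + (x ^+ 2 - gamma ^+ 2) * (alpha + beta + 3 / 2) / (2 * x)
  - (alpha + 1 / 2) / (2 * x).

Definition dunkl_V (alpha beta gamma eps x : K) : K :=
  gamma * (x ^+ 2 - gamma ^+ 2 - 1) * (x - 3 * gamma / 2) / (4 * x ^+ 4)
  - (x ^+ 2 - gamma ^+ 2) * (alpha + beta + 3 / 2) / (4 * x ^+ 2)
  + (alpha + 1 / 2) / (4 * x ^+ 2)
  + eps * ((x - gamma) / (2 * x)).

(* The coefficients have a pole at 0, where the field convention 0^-1 = 0 makes
   the value below meaningless: it is to be used for x != 0 only. *)
Definition dunkl_D (alpha beta gamma eps : K) (f : K -> K) : K -> K := fun x =>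
  dunkl_S gamma x * derive1n 2 f x
  + dunkl_T gamma x * derive1 (reflection f) x
  + dunkl_U alpha beta gamma x * derive1 f x
  + dunkl_V alpha beta gamma eps x * (f x - reflection f x).

End Chihara.

(* Main.v *)
Require Import Defs.
From mathcomp Require Import all_boot all_order all_algebra.
From mathcomp Require Import ring.
From mathcomp Require Import all_classical reals topology normedtype derive.

Set Implicit Arguments.
Unset Strict Implicit.
Unset Printing Implicit Defensive.

Import Order.TTheory GRing.Theory Num.Theory.
Import numFieldNormedType.Exports.

Local Open Scope ring_scope.

(* With w = x^2 - gamma^2, an even-degree Chihara polynomial is a multiple of
   F(w) and an odd-degree one a multiple of (x - gamma) F(w), where F solves the
   Gauss hypergeometric equation. The chain rule turns the action of the Dunkl
   operator on such functions into the hypergeometric operator at w; in the odd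
   case the coefficient of F(w) itself collapses to eps (x - gamma). *)

Lemma pochhammerS (K : numFieldType) (a : K) (n : nat) :
  pochhammer a n.+1 = pochhammer a n * (a + n%:R).
Proof. by rewrite /pochhammer big_ord_recr. Qed.

Lemma pochhammerSl (K : numFieldType) (a : K) (n : nat) :
  pochhammer a n.+1 = a * pochhammer (a + 1) n.
Proof. by rewrite -add1n pochhammerD /pochhammer big_ord1 addr0. Qed.

(** Separates the one-variable polynomial from its argument, so that [deriv_comp] supplies the chain
    rule. *)
Lemma poch_hyp2F1_comp (K : numFieldType) (n : nat) (b c : K) (z : {poly K}) :
  poch_hyp2F1 n b c z = poch_hyp2F1 n b c 'X \Po z.
Proof.
rewrite /poch_hyp2F1 linear_sum; apply: eq_bigr => k _ /=.
by rewrite linearZ /= comp_Xn_poly.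
Qed.

Lemma coef_poch_hyp2F1 (K : numFieldType) (n : nat) (b c : K) (k : nat) :
  (poch_hyp2F1 n b c 'X)`_k =
  if (k <= n)%N then
    pochhammer (- n%:R) k * pochhammer b k * pochhammer (c + k%:R) (n - k)
      / k`!%:R
  else 0.
Proof.
rewrite /poch_hyp2F1 -(poly_def n.+1 (fun k => pochhammer (- n%:R) k *
  pochhammer b k * pochhammer (c + k%:R) (n - k) / k`!%:R)).
by rewrite coef_poly ltnS.
Qed.

(** The hypergeometric ratio of consecutive coefficients, cleared of denominators so that no value
    of [c] is excluded. *)
Lemma coef_poch_hyp2F1S (K : numFieldType) (n : nat) (b c : K) (k : nat) :
  let f := poch_hyp2F1 n b c 'X in
  k.+1%:R * (c + k%:R) * f`_k.+1 = (k%:R - n%:R) * (b + k%:R) * f`_k.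
Proof.
rewrite /= !coef_poch_hyp2F1.
(* At [k = n] the factor [k - n] vanishes, matching the zero coefficient of index [n + 1]; beyond
   [n] both coefficients are zero. *)
case: (ltngtP k n) => [ltkn | _ | ->]; last by rewrite subrr !(mulr0, mul0r).
  have -> : (n - k = (n - k.+1).+1)%N by rewrite -subSn // subSS.
  rewrite (pochhammerSl (c + _)) !pochhammerS factS natrM.
  have kf0 : k`!%:R != 0 :> K by rewrite pnatr_eq0 -lt0n fact_gt0.
  have k0 : 1 + k%:R != 0 :> K by rewrite nat1r pnatr_eq0.
  rewrite -!nat1r (_ : c + (1 + k%:R) = c + k%:R + 1); last by ring.
  by field; rewrite kf0 k0.
by rewrite !mulr0.
Qed.

(** Comparing coefficients of degree [k] gives the recurrence, because [k (k - 1) + (b - n + 1) k -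
    n b = (k - n) (k + b)]. *)
Lemma poch_hyp2F1_ode (K : numFieldType) (n : nat) (b c w : K) :
  let f := poch_hyp2F1 n b c 'X in
  w * (w - 1) * f^`()^`().[w] + ((b - n%:R + 1) * w - c) * f^`().[w]
  = n%:R * b * f.[w].
Proof.
move=> f.
suff /(congr1 (horner^~ w)) :
    'X * ('X - 1) * f^`()^`() + ((b - n%:R + 1) *: 'X - c%:P) * f^`()
    = (n%:R * b) *: f by rewrite !hornerE.
apply/polyP => k.
have /eqP := coef_poch_hyp2F1S n b c k; rewrite -/f -subr_eq0 => /eqP rec.
rewrite mulrBr mulr1 !mulrBl -!scalerAl -mulrA !(coefD, coefN, coefZ, coefCM).
rewrite !coefXM !coef_deriv.
move/(congr1 -%R): rec; rewrite oppr0 => rec; apply/subr0_eq/(etrans _ rec).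
(* Degrees 0 and 1 are separate because multiplication by ['X] and by its square shifts the
   coefficients. *)
by case: k {rec} => [|[|k]] /=; ring.
Qed.

Lemma is_derive_horner (K : numFieldType) (p : {poly K}) (x : K) :
  is_derive x (1 : K) (horner p) p^`().[x].
Proof.
elim/poly_ind: p => [|p c ih].
  rewrite (_ : horner 0 = cst 0) ?deriv0 ?horner0; first exact: is_derive_cst.
  by apply/funext => y; rewrite horner0.
rewrite (_ : horner _ = horner p * id + cst c); last first.
  by apply/funext => y; rewrite !hornerE.
apply: is_derive_eq; rewrite derivD derivM derivX derivC !hornerE /=.
by rewrite /GRing.scale /= mulr1 mulrC addrC.
Qed.

Lemma derive1_horner (K : numFieldType) (p : {poly K}) :
  derive1 (horner p) = horner p^`().
Proof. by apply/funext => x; rewrite derive1E; case: (is_derive_horner p x). Qed.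

Lemma reflection_horner (K : numFieldType) (p : {poly K}) :
  reflection (horner p) = horner (p \Po - 'X).
Proof. by apply/funext => x; rewrite horner_comp !hornerE. Qed.

Lemma dunkl_D_horner (K : numFieldType) (alpha beta gamma eps : K)
    (p : {poly K}) (x : K) :
  dunkl_D alpha beta gamma eps (horner p) x =
  dunkl_S gamma x * p^`()^`().[x] - dunkl_T gamma x * p^`().[- x]
  + dunkl_U alpha beta gamma x * p^`().[x]
  + dunkl_V alpha beta gamma eps x * (p.[x] - p.[- x]).
Proof.
rewrite /dunkl_D /derive1n /= reflection_horner !derive1_horner.
by rewrite deriv_comp derivN derivX !(hornerE, horner_comp) /= mulrN1.
Qed.

(** The function is even, so the [dunkl_V] term vanishes. In the coefficient of [f'(w)] the poles
    cancel through [w + gamma^2 = x^2]. *)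
Lemma dunkl_D_even (K : numFieldType) (alpha beta gamma eps a x : K)
    (f : {poly K}) :
  x != 0 ->
  let w := x ^+ 2 - gamma ^+ 2 in
  dunkl_D alpha beta gamma eps
    (horner (a *: (f \Po ('X^2 - (gamma ^+ 2)%:P)))) x =
  a * (w * (w - 1) * f^`()^`().[w]
       + ((alpha + beta + 2) * w - (alpha + 1)) * f^`().[w]).
Proof.
move=> x0 w; rewrite dunkl_D_horner.
rewrite !(derivZ, deriv_comp, derivM, derivD, derivN, derivXn, derivX, derivC).
rewrite !(hornerE, horner_comp) /= sqrrN -/w.
rewrite /dunkl_S /dunkl_T /dunkl_U /dunkl_V /w.
by field.
Qed.

(** Here [p(x) - p(-x)] is [2 a x f(w)], and [2 x V = T - U + eps (x - gamma)]; thus only the [eps]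
    term multiplying [f(w)] survives. *)
Lemma dunkl_D_odd (K : numFieldType) (alpha beta gamma eps a x : K)
    (f : {poly K}) :
  x != 0 ->
  let w := x ^+ 2 - gamma ^+ 2 in
  dunkl_D alpha beta gamma eps
    (horner (a *: (('X - gamma%:P) * (f \Po ('X^2 - (gamma ^+ 2)%:P))))) x =
  a * (x - gamma) * (w * (w - 1) * f^`()^`().[w]
       + ((alpha + beta + 3) * w - (alpha + 2)) * f^`().[w] + eps * f.[w]).
Proof.
move=> x0 w; rewrite dunkl_D_horner.
rewrite !(derivZ, deriv_comp, derivM, derivD, derivN, derivXn, derivX, derivC).
rewrite !(hornerE, horner_comp) /= sqrrN -/w.
rewrite /dunkl_S /dunkl_T /dunkl_U /dunkl_V /w.
by field.
Qed.

Theorem proposition4p1 (K : numFieldType) (alpha beta gamma eps : K)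
    (halpha : alpha \is Num.real) (hbeta : beta \is Num.real)
    (hgamma : gamma \is Num.real)
    (hab : forall k : nat, (2 <= k)%N -> alpha + beta != - k%:R)
    (n : nat) (x : K) (hx : x != 0) :
  dunkl_D alpha beta gamma eps (fun y : K => (chihara alpha beta gamma n).[y]) x
  = chihara_eigenvalue alpha beta eps n * (chihara alpha beta gamma n).[x].
Proof.
rewrite /chihara /chihara_eigenvalue; move: (n./2) => m; case: (odd n).
  rewrite /chihara_odd poch_hyp2F1_comp dunkl_D_odd //.
  set w := x ^+ 2 - gamma ^+ 2.
  have := poch_hyp2F1_ode m (m%:R + alpha + beta + 2) (alpha + 2) w.
  (* With [b = m + alpha + beta + 2] the [m] cancels in [b - m + 1], so the operator is the same for
     all [m]; the eigenvalue is [m b + eps]. *)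
  rewrite /= (_ : _ - m%:R + 1 = alpha + beta + 3); last by ring.
  move=> ->; rewrite !(hornerE, horner_comp) /= -/w; ring.
rewrite /chihara_even poch_hyp2F1_comp dunkl_D_even //.
set w := x ^+ 2 - gamma ^+ 2.
have := poch_hyp2F1_ode m (m%:R + alpha + beta + 1) (alpha + 1) w.
(* Likewise with [b = m + alpha + beta + 1], and the eigenvalue is [m b]. *)
rewrite /= (_ : _ - m%:R + 1 = alpha + beta + 2); last by ring.
move=> ->; rewrite !(hornerE, horner_comp) /= -/w; ring.
Qed.
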